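(* Let $V$ be a vector space over a field $K$ of characteristic zero and $\mathrm{Dend}(V)$ the free dendriform algebra on $V$. Then $H^{Dend}_1(\mathrm{Dend}(V))\cong V$ and $H^{Dend}_n(\mathrm{Dend}(V))=0$ for all $n>1$.
   Context: A dendriform algebra is a vector space $E$ with bilinear $\prec,\succ$ satisfying (i) $(a\prec b)\prec c=a\prec(b\prec c)+a\prec(b\succ c)$, (ii) $(a\succ b)\prec c=a\succ(b\prec c)$, (iii) $(a\prec b)\succ c+(a\succ b)\succ c=a\succ(b\succ c)$; $a*b:=a\prec b+a\succ b$. Its chain complex: $C^{Dend}_n(E)=K[\{1,\dots,n\}]\otimes E^{\otimes n}$ with $d=-\sum_{i=1}^{n-1}(-1)^id_i$, where $d_i(r\otimes x_1\otimes\cdots\otimes x_n)=d_i(r)\otimes x_1\otimes\cdots\otimes(x_i\circ_i^rx_{i+1})\otimes\cdots\otimes x_n$, with $d_i(r)=r-1$ if $i\le r-1$, $d_i(r)=r$ if $i\ge r$, and $\circ_i^r=*$ if $i<r-1$ or $i>r$, $\circ_i^r=\succ$ if $i=r-1$, $\circ_i^r=\prec$ if $i=r$. $H^{Dend}_n(E)$ is the $n$-th homology of this complex ($n\ge1$). The free dendriform algebra $\mathrm{Dend}(V)$ is characterized by the usual universal property with respect to linear maps from $V$ (it is $\bigoplus_{n\ge1}K[Y_n]\otimes V^{\otimes n}$, $Y_n$ the planar binary trees with $n$ internal vertices). *)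

(* Defs.v *)
From HB Require Import structures.
From mathcomp Require Import all_boot all_order all_algebra.
Set Implicit Arguments. Unset Strict Implicit. Unset Printing Implicit Defensive.
Import GRing.Theory.
Local Open Scope ring_scope.

Section Dend.
Variable K : fieldType.

Definition klinear (U W : lmodType K) (f : U -> W) : Prop :=
  forall (a : K) (x y : U), f (a *: x + y) = a *: f x + f y.

Record dendAlg := DendAlg {
  dcarrier :> lmodType K;
  dpr : dcarrier -> dcarrier -> dcarrier;
  dsc : dcarrier -> dcarrier -> dcarrier;
  dpr_linl : forall z, klinear (fun x => dpr x z);
  dpr_linr : forall x, klinear (fun z => dpr x z);
  dsc_linl : forall z, klinear (fun x => dsc x z);
  dsc_linr : forall x, klinear (fun z => dsc x z);
  dend_ax1 : forall a b c, dpr (dpr a b) c = dpr a (dpr b c) + dpr a (dsc b c);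
  dend_ax2 : forall a b c, dpr (dsc a b) c = dsc a (dpr b c);
  dend_ax3 : forall a b c, dsc (dpr a b) c + dsc (dsc a b) c = dsc a (dsc b c)
}.

Definition dstar (E : dendAlg) (a b : E) : E := dpr a b + dsc a b.

Definition dend_morph (A B : dendAlg) (g : A -> B) : Prop :=
  klinear g /\ (forall x y, g (dpr x y) = dpr (g x) (g y))
            /\ (forall x y, g (dsc x y) = dsc (g x) (g y)).

Definition free_dend_on (V : lmodType K) (E : dendAlg) (i : V -> E) : Prop :=
  klinear i /\
  forall (A : dendAlg) (f : V -> A), klinear f ->
    exists g : E -> A, [/\ dend_morph g, (forall v, g (i v) = f v) &
      forall g' : E -> A, dend_morph g' -> (forall v, g' (i v) = f v) ->
        forall x, g' x = g x].

(* ---- The chain complex C^Dend_n(E) = K[{1..n}] (x) E^(x)n ----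
   An element is represented by a formal sum: a list of terms
   (k, r, [x_1; ...; x_n]) standing for k * (r (x) x_1 (x) ... (x) x_n),
   with 1 <= r <= n.  Such a formal sum is zero in C_n(E) iff it is killed
   by every K-linear map out of C_n(E), i.e. (universal property of the
   tensor product) by every family (phi_r)_r of n-multilinear maps into
   any K-vector space W. *)
Section Chains.
Variable E : dendAlg.

Definition term := (K * nat * seq E)%type.

Definition wf_chain (n : nat) (c : seq term) : bool :=
  all (fun t => (0 < t.1.2 <= n)%N && (size t.2 == n)) c.

Definition multilinear (W : lmodType K) (n : nat) (phi : nat -> seq E -> W) : Prop :=
  forall (r : nat) (s1 s2 : seq E) (a : K) (x y : E),
    (size s1 + (size s2).+1)%N = n ->
    phi r (s1 ++ (a *: x + y) :: s2) =
      a *: phi r (s1 ++ x :: s2) + phi r (s1 ++ y :: s2).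

Definition eval_chain (W : lmodType K) (phi : nat -> seq E -> W) (c : seq term) : W :=
  \sum_(t <- c) t.1.1 *: phi t.1.2 t.2.

Definition chain_zero (n : nat) (c : seq term) : Prop :=
  forall (W : lmodType K) (phi : nat -> seq E -> W),
    multilinear n phi -> eval_chain phi c = 0.

Definition chain_opp (c : seq term) : seq term :=
  map (fun t => (- t.1.1, t.1.2, t.2)) c.

Definition face_idx (i r : nat) : nat := if (i < r)%N then r.-1 else r.

Definition face_op (i r : nat) : E -> E -> E :=
  if (i.+1 < r)%N then @dstar E
  else if i.+1 == r then @dsc E
  else if i == r then @dpr E
  else @dstar E.

(* x_1 (x) ... (x) (x_i o x_{i+1}) (x) ... (x) x_n   (i is 1-based) *)
Definition face_tensor (i r : nat) (x : seq E) : seq E :=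
  take i.-1 x ++ face_op i r (nth 0 x i.-1) (nth 0 x i) :: drop i.+1 x.

(* the i-th face together with the sign of d = - sum_i (-1)^i d_i *)
Definition signed_face (i : nat) (t : term) : term :=
  ((-1) ^+ i.+1 * t.1.1, face_idx i t.1.2, face_tensor i t.1.2 t.2).

Definition boundary (n : nat) (c : seq term) : seq term :=
  flatten [seq [seq signed_face i t | i <- iota 1 n.-1] | t <- c].

Definition is_cycle (n : nat) (c : seq term) : Prop :=
  chain_zero n.-1 (boundary n c).

Definition is_boundary (n : nat) (c : seq term) : Prop :=
  exists b, wf_chain n.+1 b /\ chain_zero n (c ++ chain_opp (boundary n.+1 b)).

Definition homology_vanishes (n : nat) : Prop :=
  forall c, wf_chain n c -> is_cycle n c -> is_boundary n c.

(* H^Dend_n(E) is isomorphic to V: there is a K-linear map C_n(E) -> V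
   (given as a family of multilinear maps) whose restriction to cycles is
   surjective with kernel exactly the boundaries. *)
Definition homology_iso (n : nat) (V : lmodType K) : Prop :=
  exists psi : nat -> seq E -> V,
    [/\ multilinear n psi,
        (forall v : V, exists c, [/\ wf_chain n c, is_cycle n c & eval_chain psi c = v]) &
        (forall c, wf_chain n c -> is_cycle n c ->
           (eval_chain psi c = 0 <-> is_boundary n c))].

End Chains.
End Dend.

(* Main.v *)
(** Write [A = K + E] for the unitalization of the associative algebra [(E, star)].
    The axioms say that [E] is an [A]-bimodule ([dsc] on the left, [dpr] on the
    right), and that the term [r (x) x_1 ... x_n] of the complex is a tensor whose
    [r]-th entry is a bimodule element: [C_n] is the two-sided bar complex computing
    [K (x)_A^L E (x)_A^L K].  When [E] is free on [V] it is the free bimodule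
    [A (x) V (x) A], because square-zero extensions by bimodules are dendriform.
    Hence the left contraction [l > v < r |-> l (x) (v < r)] and its mirror image give
    a contracting homotopy in degrees [> 1].  Since chains are tested against
    multilinear maps, everything is carried out on functionals: [cobd] and
    [homotopy] are the transposes of the boundary and of the homotopy. *)
Require Import Defs.
From HB Require Import structures.
From mathcomp Require Import all_boot all_order all_algebra.
From mathcomp Require Import boolp functions zify.
Set Implicit Arguments. Unset Strict Implicit. Unset Printing Implicit Defensive.
Import GRing.Theory.
Local Open Scope ring_scope.

(** * Linear maps, and subspaces cut out by a predicate *)

Section Klinear.
Variables (K : fieldType) (U W : lmodType K).
Implicit Types f g : U -> W.

Lemma klinearD f : klinear f -> {morph f : x y / x + y}.
Proof. by move=> lf x y; rewrite -[x]scale1r lf !scale1r. Qed.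

Lemma klinear0 f : klinear f -> f 0 = 0.
Proof. by move=> lf; apply: (@addrI _ (f 0)); rewrite -klinearD // !addr0. Qed.

Lemma klinearZ f : klinear f -> forall a, {morph f : x / a *: x}.
Proof. by move=> lf a x; rewrite -[_ *: x]addr0 lf klinear0 // addr0. Qed.

Lemma klinearN f : klinear f -> {morph f : x / - x}.
Proof. by move=> lf x; rewrite -!scaleN1r klinearZ. Qed.

Lemma klinearB f : klinear f -> {morph f : x y / x - y}.
Proof. by move=> lf x y; rewrite klinearD // klinearN. Qed.

Lemma klinear_sum f : klinear f -> forall (I : Type) (s : seq I) (F : I -> U),
  f (\sum_(j <- s) F j) = \sum_(j <- s) f (F j).
Proof.
by move=> lf I s F; apply: big_morph; [exact: klinearD | exact: klinear0].
Qed.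

Lemma klinear_add f g : klinear f -> klinear g -> klinear (fun x => f x + g x).
Proof. by move=> lf lg a x y; rewrite lf lg scalerDr addrACA. Qed.

Lemma klinear_scale c f : klinear f -> klinear (fun x => c *: f x).
Proof. by move=> lf a x y; rewrite lf scalerDr !scalerA mulrC. Qed.

Lemma klinear_big (I : Type) (s : seq I) (P : pred I) (F : I -> U -> W) :
  (forall j, P j -> klinear (F j)) -> klinear (fun x => \sum_(j <- s | P j) F j x).
Proof.
move=> lF a x y; rewrite scaler_sumr -big_split /=.
by apply: eq_bigr => j Pj; rewrite lF.
Qed.

Lemma klinear_cst0 : klinear (fun _ : U => 0 : W).
Proof. by move=> a x y; rewrite scaler0 addr0. Qed.

End Klinear.

Lemma klinear_id (K : fieldType) (U : lmodType K) : klinear (@id U).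
Proof. by []. Qed.

Lemma klinear_comp (K : fieldType) (U W X : lmodType K) (f : W -> X) (g : U -> W) :
  klinear f -> klinear g -> klinear (fun x => f (g x)).
Proof. by move=> lf lg a x y; rewrite lg lf. Qed.

Section SubLmodule.
Variables (K : fieldType) (L : lmodType K) (P : L -> Prop).

Definition lin_closed := P 0 /\ forall a x y, P x -> P y -> P (a *: x + y).

Variable closedP : lin_closed.

Definition sub_pred : {pred L} := fun x => `[< P x >].

Lemma sub_pred_closed : GRing.subsemimod_closed sub_pred.
Proof.
case: closedP => P0 PZD; split; first split.
- exact/asboolP.
- move=> x y /asboolP Px /asboolP Py; apply/asboolP.
  by rewrite -[x]scale1r; apply: PZD.
- move=> a x /asboolP Px; apply/asboolP.
  by rewrite -[_ *: x]addr0; apply: PZD.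
Qed.

(** The closedness proof is a phantom argument, so that a module structure depending on it can be
    attached to the type. *)
Definition sub_type of lin_closed := {x : L | sub_pred x}.
Local Notation S := (sub_type closedP).
HB.instance Definition _ := SubChoice.on S.
HB.instance Definition _ :=
  GRing.SubChoice_isSubLmodule.Build K L sub_pred S sub_pred_closed.

Definition to_sub (x : L) (Px : P x) : S := exist (fun y => sub_pred y) x (asboolT Px).

Lemma sub_typeP (u : S) : P (val u).
Proof. by apply/asboolP; exact: (valP u). Qed.


End SubLmodule.

(** * The associative product [dstar] and its two actions on [E] *)

Section Star.
Variables (K : fieldType) (E : dendAlg K).
Implicit Types a b c : E.

Lemma dstar_linl c : klinear (fun a => dstar a c).
Proof. by apply: klinear_add; [exact: dpr_linl | exact: dsc_linl]. Qed.

Lemma dstar_linr a : klinear (dstar a).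
Proof. by apply: klinear_add; [exact: dpr_linr | exact: dsc_linr]. Qed.

(** Associativity is the sum of the three dendriform axioms. *)
Lemma dstarA : associative (@dstar K E).
Proof.
move=> a b c; rewrite /dstar.
rewrite (klinearD (dpr_linl _)) (klinearD (dsc_linl _)) dend_ax3 dend_ax1 dend_ax2.
rewrite (klinearD (dpr_linr _)) (klinearD (dsc_linr _)).
by rewrite !addrA.
Qed.

Lemma dpr_dpr a b c : dpr (dpr a b) c = dpr a (dstar b c).
Proof. by rewrite dend_ax1 -(klinearD (dpr_linr _)). Qed.

Lemma dsc_dsc a b c : dsc a (dsc b c) = dsc (dstar a b) c.
Proof. by rewrite -dend_ax3 -(klinearD (dsc_linl _)). Qed.

End Star.

(** * Consequences of the universal property: induction and free bimodules *)

Section FreeGen.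
Variables (K : fieldType) (V : lmodType K) (E : dendAlg K) (i : V -> E).
Hypothesis freeE : free_dend_on i.

Lemma free_klin : klinear i. Proof. by case: freeE. Qed.

(** Both [g] and the identity extend [i], so uniqueness of the extension identifies them. *)
Lemma free_ext_id (g : E -> E) :
  dend_morph g -> (forall v, g (i v) = i v) -> forall x, g x = x.
Proof.
case: freeE => li /(_ E i li) [h [_ _ uh]] mg gi x.
rewrite (uh g) // -(uh id) //.
Qed.

Section SubDend.
Variables (P : E -> Prop) (cP : lin_closed P).
Hypotheses (Ppr : forall x y, P x -> P y -> P (dpr x y))
           (Psc : forall x y, P x -> P y -> P (dsc x y)).
Let S := sub_type cP.
Let spr (u v : S) : S := to_sub cP (Ppr (@sub_typeP _ _ _ cP u) (@sub_typeP _ _ _ cP v)).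
Let ssc (u v : S) : S := to_sub cP (Psc (@sub_typeP _ _ _ cP u) (@sub_typeP _ _ _ cP v)).

Definition sub_dend : dendAlg K.
Proof.
apply: (@DendAlg K S spr ssc) => [z a x y|z a x y|z a x y|z a x y|a b c|a b c|a b c];
  apply: val_inj => /=.
- exact: dpr_linl.
- exact: dpr_linr.
- exact: dsc_linl.
- exact: dsc_linr.
- exact: dend_ax1.
- exact: dend_ax2.
- exact: dend_ax3.
Defined.

(** [P] cuts out a subalgebra containing the generators. Extending [i] into it and composing with
    the inclusion gives an endomorphism that fixes the generators, hence the identity. *)
Lemma free_ind_sub : (forall v, P (i v)) -> forall x, P x.
Proof.
move=> Pi x; case: freeE => li /(_ sub_dend (fun v => to_sub cP (Pi v))).
case=> [a v w|g [[lg [gpr gsc]] gi _]]; first exact/val_inj/li.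
suff <- : val (g x) = x by exact: sub_typeP.
apply: (free_ext_id (g := fun x => val (g x))) => [|v]; last by rewrite gi.
split; first by move=> a y z; rewrite lg.
by split=> y z; rewrite ?gpr ?gsc.
Qed.

End SubDend.

Lemma free_ind (P : E -> Prop) :
  (forall v, P (i v)) -> (forall a x y, P x -> P y -> P (a *: x + y)) ->
  (forall x y, P x -> P y -> P (dpr x y)) ->
  (forall x y, P x -> P y -> P (dsc x y)) -> forall x, P x.
Proof.
move=> Pi PZD Ppr Psc; apply: free_ind_sub => //; split=> //.
(* [P 0] is an instance of the generator case, since [0 = i 0]. *)
by rewrite -(klinear0 free_klin).
Qed.

Section Bimodule.
Variables (M : lmodType K) (la : E -> M -> M) (ra : M -> E -> M).
Hypotheses (la_linl : forall m, klinear (la^~ m)) (la_linr : forall a, klinear (la a)).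
Hypotheses (ra_linl : forall a, klinear (ra^~ a)) (ra_linr : forall m, klinear (ra m)).
Hypotheses (laA : forall a b m, la a (la b m) = la (dstar a b) m)
           (raA : forall m a b, ra (ra m a) b = ra m (dstar a b))
           (laraA : forall a m b, ra (la a m) b = la a (ra m b)).

(** The products [dpr] of [E] with [M] and [dsc] of [M] with [E] are set to zero. On the [M]
    component each dendriform axiom then becomes exactly one bimodule law. *)
Definition bimod_ext : dendAlg K.
Proof.
apply: (@DendAlg K (E * M)%type (fun x y => (dpr x.1 y.1, ra x.2 y.1))
  (fun x y => (dsc x.1 y.1, la x.1 y.2)))
  => [z a x y|z a x y|z a x y|z a x y|a b c|a b c|a b c]; congr (_, _) => /=.
- exact: dpr_linl.
- exact: ra_linl.
- exact: dpr_linr.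
- exact: ra_linr.
- exact: dsc_linl.
- exact: la_linl.
- exact: dsc_linr.
- exact: la_linr.
- exact: dend_ax1.
- by rewrite raA -(klinearD (ra_linr _)).
- exact: dend_ax2.
- exact: laraA.
- exact: dend_ax3.
- by rewrite laA -(klinearD (la_linl _)).
Defined.

(* A free dendriform algebra is the free bimodule on [V] over its own
   associative algebra: square-zero extensions of [E] by bimodules are again
   dendriform, and they lift [id]. *)
Lemma free_bimodule (f : V -> M) : klinear f ->
  exists D : E -> M, [/\ klinear D, forall v, D (i v) = f v,
    forall x y, D (dpr x y) = ra (D x) y & forall x y, D (dsc x y) = la x (D y)].
Proof.
move=> lf; case: freeE => li /(_ bimod_ext (fun v => (i v, f v))).
case=> [a v w|g [[lg [gpr gsc]] gi _]]; first by rewrite li lf.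
have g1 x : (g x).1 = x.
  apply: (free_ext_id (g := fun x => (g x).1)) => [|v]; last by rewrite gi.
  split; first by move=> a y z; rewrite lg.
  by split=> y z; rewrite ?gpr ?gsc.
exists (fun x => (g x).2); split=> [a x y|v|x y|x y].
- by rewrite lg.
- by rewrite gi.
- by rewrite gpr /= g1.
- by rewrite gsc /= g1.
Qed.

End Bimodule.
End FreeGen.

(** * The unitalization, its actions on [E], and coinduced bimodules *)

Section Unitalization.
Variables (K : fieldType) (E : dendAlg K).

Local Notation A := (K^o * E)%type.
Implicit Types (p q : A) (a b x y : E).

Lemma scale_regA (k : K) (c : K^o) x : ((k *: c : K^o) : K) *: x = k *: ((c : K) *: x).
Proof. by rewrite scalerA. Qed.

Definition lact p x := (p.1 : K) *: x + dsc p.2 x.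
Definition ract x p := (p.1 : K) *: x + dpr x p.2.
(** The product in the unitalization of [p] with an element of [E]. Its scalar part is [0] because
    [E] is the augmentation ideal. *)
Definition mulr_aug p a : A := (0, (p.1 : K) *: a + dstar p.2 a).
Definition mull_aug a p : A := (0, (p.1 : K) *: a + dstar a p.2).

Lemma ract_linr x : klinear (ract x).
Proof.
move=> k p q; rewrite /ract /= dpr_linr scalerDl scale_regA scalerDr.
by rewrite addrACA.
Qed.

Lemma lact_dpr p x y : dpr (lact p x) y = lact p (dpr x y).
Proof.
by rewrite /lact (klinearD (dpr_linl _)) (klinearZ (dpr_linl _)) dend_ax2.
Qed.

Lemma ract_dpr p x y : dpr (ract x p) y = ract x (mulr_aug p y).
Proof.
rewrite /ract (klinearD (dpr_linl _)) (klinearZ (dpr_linl _)) dpr_dpr /=.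
by rewrite scale0r add0r dpr_linr.
Qed.

Lemma dsc_lact p x y : dsc y (lact p x) = lact (mull_aug y p) x.
Proof.
rewrite /lact (klinearD (dsc_linr _)) (klinearZ (dsc_linr _)) dsc_dsc /=.
by rewrite scale0r add0r dsc_linl.
Qed.

Lemma mulr_aug_linl a : klinear (mulr_aug^~ a).
Proof.
move=> k p q; apply: injective_projections => /=; first by rewrite scaler0 addr0.
by rewrite dstar_linl scalerDl scale_regA !scalerDr addrACA.
Qed.

Lemma mulr_aug_linr p : klinear (mulr_aug p).
Proof.
move=> k x y; apply: injective_projections => /=; first by rewrite scaler0 addr0.
by rewrite dstar_linr !scalerDr !scalerA mulrC addrACA.
Qed.

Lemma mull_aug_linl p : klinear (mull_aug^~ p).
Proof.
move=> k x y; apply: injective_projections => /=; first by rewrite scaler0 addr0.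
by rewrite dstar_linl !scalerDr !scalerA mulrC addrACA.
Qed.

Lemma mull_aug_linr a : klinear (mull_aug a).
Proof.
move=> k p q; apply: injective_projections => /=; first by rewrite scaler0 addr0.
by rewrite dstar_linr scalerDl scale_regA !scalerDr addrACA.
Qed.

Lemma mulr_augA p a b : mulr_aug (mulr_aug p a) b = mulr_aug p (dstar a b).
Proof.
rewrite /mulr_aug /= scale0r add0r (klinearD (dstar_linl _)).
by rewrite (klinearZ (dstar_linl _)) dstarA.
Qed.

Lemma mull_augA p a b : mull_aug a (mull_aug b p) = mull_aug (dstar a b) p.
Proof.
rewrite /mull_aug /= scale0r add0r (klinearD (dstar_linr _)).
by rewrite (klinearZ (dstar_linr _)) dstarA.
Qed.

Section Coinduced.
Variable W : lmodType K.

Definition bilinear_on (f : A -> A -> W) : Prop :=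
  (forall q, klinear (f^~ q)) /\ (forall p, klinear (f p)).

Lemma bilinear_on_closed : lin_closed bilinear_on.
Proof.
split; first by split=> z a x y; rewrite /= scaler0 addr0.
move=> c f g [fl fr] [gl gr]; split=> z.
  exact: (klinear_add (klinear_scale c (fl z)) (gl z)).
exact: (klinear_add (klinear_scale c (fr z)) (gr z)).
Qed.

Local Notation M := (sub_type bilinear_on_closed).

Lemma coind_la_subproof a (m : M) : bilinear_on (fun p q => val m (mulr_aug p a) q).
Proof.
case: (sub_typeP m) => ml mr; split=> z; last exact: mr.
exact: (klinear_comp (ml z) (mulr_aug_linl a)).
Qed.

Lemma coind_ra_subproof (m : M) a : bilinear_on (fun p q => val m p (mull_aug a q)).
Proof.
case: (sub_typeP m) => ml mr; split=> z; first exact: ml.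
exact: (klinear_comp (mr z) (mull_aug_linr a)).
Qed.

(** The value [m p q] plays the role of a functional evaluated at [p . m . q], so acting by [a]
    multiplies the inner side of the neighbouring argument. *)
Definition coind_la a m : M := to_sub bilinear_on_closed (coind_la_subproof a m).
Definition coind_ra m a : M := to_sub bilinear_on_closed (coind_ra_subproof m a).

Lemma coind_eq (m m' : M) : (forall p q, val m p q = val m' p q) -> m = m'.
Proof. by move=> e; apply/val_inj/funext => p; apply/funext => q. Qed.

End Coinduced.
End Unitalization.

(** * The left contraction on a free dendriform algebra *)

Section Contraction.
Variables (K : fieldType) (V : lmodType K) (E : dendAlg K) (i : V -> E).
Hypothesis freeE : free_dend_on i.
Local Notation A := (K^o * E)%type.

Definition bilinear_map (W : lmodType K) (B : E -> E -> W) : Prop :=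
  (forall y, klinear (B^~ y)) /\ (forall x, klinear (B x)).

(* [L] is read off at [(1, 1)] from the bimodule map into the coinduced
   bimodule [Hom(A (x) A, W)] sending [v] to [(p, q) |-> B p (v < q)], where
   [B] is extended by [0] on the unit. *)
Lemma contraction_exists (W : lmodType K) (B : E -> E -> W) : bilinear_map B ->
  exists2 L : E -> W, klinear L &
    forall (p : A) v (q : A), L (lact p (ract (i v) q)) = B p.2 (ract (i v) q).
Proof.
move=> [Bl Br].
have bf v : bilinear_on (fun p q : A => B p.2 (ract (i v) q)).
  split=> z a x y /=; first exact: Bl.
  by rewrite ract_linr Br.
case: (free_bimodule freeE (la := @coind_la K E W) (ra := @coind_ra K E W) _ _ _ _ _ _ _
  (f := fun v => to_sub (@bilinear_on_closed K E W) (bf v))).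
- move=> m a x y; apply: coind_eq => p q /=; case: (sub_typeP m) => ml _.
  by rewrite mulr_aug_linr ml.
- by move=> a k x y; apply: coind_eq.
- by move=> a k x y; apply: coind_eq.
- move=> m a x y; apply: coind_eq => p q /=; case: (sub_typeP m) => _ mr.
  by rewrite mull_aug_linl mr.
- by move=> a b m; apply: coind_eq => p q /=; rewrite mulr_augA.
- by move=> a b m; apply: coind_eq => p q /=; rewrite mull_augA.
- by move=> a b m; apply: coind_eq.
- move=> a x y; apply: coind_eq => p q /=.
  rewrite /ract (free_klin freeE) (klinearD (dpr_linl _)) (klinearZ (dpr_linl _)).
  rewrite scalerDr scalerA mulrC -scalerA addrACA -scalerDr.
  by rewrite Br.
move=> D [lD Di Dpr Dsc].
have lev (p q : A) : klinear (fun x => val (D x) p q).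
  by move=> a x y; rewrite lD.
exists (fun x => val (D x) (1, 0) (1, 0)) => [|p v q]; first exact: lev.
(* At the unit [(1, 0)], the right action by [r] becomes evaluation at [r]. *)
have Dr x r p' : val (D (ract x r)) p' (1, 0) = val (D x) p' r.
  rewrite /ract (klinearD (lev _ _)) (klinearZ (lev _ _)) Dpr /=.
  have [_ mr] := sub_typeP (D x); rewrite -mr; congr (val (D x) p' _).
  apply: injective_projections => /=; first by rewrite addr0; exact: mulr1.
  by rewrite scaler0 add0r scale1r (klinear0 (dstar_linr _)) addr0.
(* The scalar part of [p] contributes a multiple of [B 0 _ = 0]; only [p.2] survives. *)
rewrite {1}/lact (klinearD (lev _ _)) (klinearZ (lev _ _)) Dsc /= !Dr Di /=.
by rewrite (klinear0 (Bl _)) scaler0 add0r scale1r (klinear0 (dstar_linl _)) addr0.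
Qed.

(** The image in [E] of the pure tensor [p (x) v (x) q] of the free bimodule. *)
Definition gen (t : A * V * A) : E := lact t.1.1 (ract (i t.1.2) t.2).

(** Sums of generators are stable under both products: a right factor of [dpr] is absorbed into [q],
    a left factor of [dsc] into [p], and only the other argument has to be expanded. *)
Lemma gen_span x : exists s : seq (A * V * A), x = \sum_(t <- s) gen t.
Proof.
elim/(free_ind freeE): x => [v|a x y [s ->] [s' ->]|x y [s ->] _|x y _ [s ->]].
- exists [:: ((1, 0), v, (1, 0))]; rewrite big_seq1 /gen /lact /ract /= !scale1r.
  by rewrite (klinear0 (dpr_linr _)) (klinear0 (dsc_linl _)) !addr0.
- exists ([seq (a *: t.1.1, t.1.2, t.2) | t <- s] ++ s').
  rewrite big_cat big_map /=; congr (_ + _); rewrite scaler_sumr.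
  apply: eq_bigr => -[[p v] q] _; rewrite /gen /lact /= (klinearZ (dsc_linl _)).
  by rewrite scalerDr scalerA.
- exists [seq (t.1.1, t.1.2, mulr_aug t.2 y) | t <- s].
  rewrite (klinear_sum (dpr_linl _)) big_map; apply: eq_bigr => -[[p v] q] _.
  by rewrite /gen lact_dpr ract_dpr.
- exists [seq (mull_aug x t.1.1, t.1.2, t.2) | t <- s].
  rewrite (klinear_sum (dsc_linr _)) big_map; apply: eq_bigr => -[[p v] q] _.
  by rewrite /gen dsc_lact.
Qed.

(* [dec x] lists the pure tensors of an element of [E (x) E]; [contr dec B] is the
   image of that element under the linear map induced by [B]. *)
Definition contr (dec : E -> seq (E * E)) (W : lmodType K) (B : E -> E -> W) x : W :=
  \sum_(t <- dec x) B t.1 t.2.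

(** For the [dec] constructed below this sends [p . v . q] to [p.1 *: (v . q)]: the augmentation
    applied to the left factor. *)
Definition residue (dec : E -> seq (E * E)) (x : E) : E := x - contr dec (@dsc K E) x.

(** These are identities in [E (x) E], tested on bilinear maps because [dec] itself is a non-linear
    choice of representatives. The residue in the last clause comes from the scalar part of [p],
    which turns into [p.1 *: x] when [p] is multiplied by [x]. *)
Definition left_contraction (dec : E -> seq (E * E)) : Prop :=
  forall (W : lmodType K) (B : E -> E -> W), bilinear_map B ->
  [/\ klinear (contr dec B),
      forall x y, contr dec B (dpr x y) = contr dec (fun l z => B l (dpr z y)) x &
      forall x y, contr dec B (dsc x y) =
        B x (residue dec y) + contr dec (fun l z => B (dstar x l) z) y].

(** The spanning sums are chosen arbitrarily; once contracted with [B] they give the linear map [L]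
    of [contraction_exists], so the choice no longer matters and each clause can be checked on
    generators. *)
Lemma left_contraction_exists : exists dec, left_contraction dec.
Proof.
have [s xs] := choice gen_span.
pose dec x := [seq (t.1.1.2, ract (i t.1.2) t.2) | t <- s x]; exists dec.
have resE x : residue dec x = \sum_(t <- s x) (t.1.1.1 : K) *: ract (i t.1.2) t.2.
  rewrite /residue {1}[x]xs /contr big_map -sumrB; apply: eq_bigr => t _.
  by rewrite /gen /lact /= addrK.
move=> W B bB; have [Bl Br] := bB; have [L lL Lgen] := contraction_exists bB.
have LE x : contr dec B x = L x.
  rewrite [in RHS](xs x) (klinear_sum lL) /contr big_map.
  by apply: eq_bigr => t _; rewrite /gen Lgen.
split=> [a x y|x y|x y]; rewrite !LE.
- exact: lL.
- rewrite [in LHS](xs x) (klinear_sum (dpr_linl _)) (klinear_sum lL) /contr big_map.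
  by apply: eq_bigr => t _; rewrite /gen lact_dpr ract_dpr Lgen.
- rewrite resE (klinear_sum (Br _)) [in LHS](xs y) (klinear_sum (dsc_linr _)).
  rewrite (klinear_sum lL) /contr big_map -big_split; apply: eq_bigr => t _ /=.
  by rewrite /gen dsc_lact Lgen /= Bl (klinearZ (Br _)).
Qed.

End Contraction.

(** * The right contraction, by passing to the opposite algebra *)

Section Opposite.
Variables (K : fieldType) (V : lmodType K) (E : dendAlg K) (i : V -> E).

(** Reversing the arguments and exchanging the two products swaps the first and third axioms and
    preserves the second. *)
Definition op_dend (A : dendAlg K) : dendAlg K.
Proof.
apply: (@DendAlg K A (fun x y => dsc y x) (fun x y => dpr y x)) => [z|z|z|z|a b c|a b c|a b c].
- exact: dsc_linr.
- exact: dsc_linl.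
- exact: dpr_linr.
- exact: dpr_linl.
- by rewrite -dend_ax3 addrC.
- by rewrite dend_ax2.
- by rewrite dend_ax1 addrC.
Defined.

Lemma free_op : free_dend_on i -> free_dend_on (i : V -> op_dend E).
Proof.
case=> li freeE; split=> // A f /(freeE (op_dend A)) [g [[lg [gpr gsc]] gi ug]].
exists g; split=> // [|g' [lg' [gpr' gsc']] gi' x].
  by split=> //; split=> x y; rewrite ?gpr ?gsc.
by apply: ug => //; split=> //; split=> y z; rewrite ?gpr' ?gsc'.
Qed.

(** The mirror image, splitting off the right factor; [x - contr dec (@dpr K E) x] is the mirror
    residue. *)
Definition right_contraction (dec : E -> seq (E * E)) : Prop :=
  forall (W : lmodType K) (B : E -> E -> W), bilinear_map B ->
  klinear (contr dec B) /\
  forall x y, contr dec B (dpr x y) =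
    B (x - contr dec (@dpr K E) x) y + contr dec (fun z t => B z (dstar t y)) x.

Lemma right_contraction_exists : free_dend_on i -> exists dec, right_contraction dec.
Proof.
move=> /free_op /left_contraction_exists [dec decP].
pose dec' (x : E) : seq (E * E) := [seq (t.2, t.1) | t <- dec x].
exists dec' => W B [Bl Br].
have E0 (W' : lmodType K) (B' : E -> E -> W') (x : E) :
  contr dec' B' x
    = contr (E := op_dend E) dec (fun l z => B' z l) x.
  by rewrite /contr big_map.
case: (decP W (fun l z => B z l)) => [|lin _ eq_sc]; first by split.
split=> [a x y|x y]; rewrite !E0; first exact: lin.
rewrite (eq_sc y x) /residue; congr (_ + _); apply: eq_bigr => t _ /=.
by rewrite /dstar /= addrC.
Qed.

End Opposite.

(** * Linearity of contractions, and splitting of sequences *)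

Section ContrLinear.
Variables (K : fieldType) (E : dendAlg K) (dec : E -> seq (E * E)) (W : lmodType K).
Implicit Types B : E -> E -> W.

Lemma contrD B1 B2 x :
  contr dec (fun l y => B1 l y + B2 l y) x = contr dec B1 x + contr dec B2 x.
Proof. exact: big_split. Qed.

Lemma contrZ k B x : contr dec (fun l y => k *: B l y) x = k *: contr dec B x.
Proof. by rewrite /contr scaler_sumr. Qed.

Lemma contr_sum (I : Type) (s : seq I) (B : I -> E -> E -> W) x :
  contr dec (fun l y => \sum_(j <- s) B j l y) x = \sum_(j <- s) contr dec (B j) x.
Proof. exact: exchange_big. Qed.

Lemma klinear_contr (X : lmodType K) (F : E -> E -> X -> W) x :
  (forall l y, klinear (F l y)) -> klinear (fun z => contr dec (fun l y => F l y z) x).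
Proof. by move=> lF; apply: klinear_big. Qed.

End ContrLinear.

Lemma seq_split_at (T : Type) (p : nat) (s : seq T) : (p < size s)%N ->
  exists u x v, s = u ++ x :: v /\ size u = p.
Proof.
move=> ps; have x0 : T by case: s ps.
exists (take p s), (nth x0 s p), (drop p.+1 s).
by rewrite -drop_nth // cat_take_drop size_takel // ltnW.
Qed.

Lemma split_pair (T : Type) (x0 : T) (u : seq T) (a b : T) (v : seq T) :
  [/\ take (size u) (u ++ a :: b :: v) = u, nth x0 (u ++ a :: b :: v) (size u) = a,
      nth x0 (u ++ a :: b :: v) (size u).+1 = b &
      drop (size u).+2 (u ++ a :: b :: v) = v].
Proof.
split; first by rewrite take_size_cat.
- by rewrite nth_cat ltnn subnn.
- by rewrite -cat_rcons nth_cat size_rcons ltnn subnn.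
- by rewrite -cat_rcons -cat_rcons drop_size_cat // !size_rcons.
Qed.

(** * Functionals with a marked entry, and the coboundary split at the mark *)

Section MarkedComplex.
Variables (K : fieldType) (E : dendAlg K).

(** The face merging entries [j] and [j.+1], counted from [0], on one side of the mark;
    [face_tensor] counts from [1]. *)
Definition star_at (j : nat) (s : seq E) : seq E :=
  take j s ++ dstar (nth 0 s j) (nth 0 s j.+1) :: drop j.+2 s.

Lemma size_star_at j s : (j.+1 < size s)%N -> size (star_at j s) = (size s).-1.
Proof.
move=> js; rewrite size_cat /= size_take size_drop (ltn_trans (ltnSn _) js).
by lia.
Qed.

Lemma star_at_neq0 j s : star_at j s != [::].
Proof. by rewrite /star_at; case: (take j s). Qed.

Lemma star_at_rcons j s l : (j.+1 < size s)%N ->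
  star_at j (rcons s l) = rcons (star_at j s) l.
Proof.
move=> js; have jls := ltn_trans (ltnSn _) js.
rewrite /star_at !nth_rcons js jls rcons_cat /= -!cats1.
rewrite take_cat jls drop_cat; case: ltnP => // sj.
by rewrite (_ : (j.+2 - size s)%N = 0%N) ?drop0 ?(drop_oversize sj) -?catA //; lia.
Qed.

Lemma star_at_last u a l : star_at (size u) (rcons (rcons u a) l) = rcons u (dstar a l).
Proof.
rewrite /star_at !nth_rcons size_rcons ltnSn !ltnn !eqxx -!cats1 -!catA.
by rewrite take_size_cat // drop_oversize ?size_cat //= addn2.
Qed.

Variable W : lmodType K.
Implicit Types (a b x y : E) (u v s : seq E).
Implicit Types (F : seq E -> E -> seq E -> W) (phi : nat -> seq E -> W).

(* A marked functional [F s1 x s2] stands for the component [r = size s1 + 1], the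
   entry [x] being the bimodule element. *)
Definition mark phi s1 x s2 : W := phi (size s1).+1 (s1 ++ x :: s2).

(** The value [0] for a mark out of range makes the result multilinear for every [r], as
    [multilinear] demands. *)
Definition unmark F (r : nat) (xs : seq E) : W :=
  if (0 < r <= size xs)%N then F (take r.-1 xs) (nth 0 xs r.-1) (drop r xs) else 0.

Definition marked_multilinear (n : nat) F : Prop :=
  [/\ forall s1 s2, (size s1 + (size s2).+1)%N = n -> klinear (fun x => F s1 x s2),
      forall u1 u2 x s2, (size u1 + (size u2).+1 + (size s2).+1)%N = n ->
        klinear (fun z => F (u1 ++ z :: u2) x s2) &
      forall s1 x u1 u2, (size s1 + (size u1 + (size u2).+1).+1)%N = n ->
        klinear (fun z => F s1 x (u1 ++ z :: u2))].

Lemma mark_multilinear n phi : multilinear n phi -> marked_multilinear n (mark phi).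
Proof.
move=> lin; split=> [s1 s2 e|u1 u2 x s2 e|s1 x u1 u2 e] a y z; rewrite /mark.
- exact: lin.
- by rewrite !size_cat /= -!catA /= lin // size_cat /= -e -addnA.
- by rewrite -!cat_cons !catA lin // size_cat /= -e -addnA.
Qed.

Lemma unmarkE F s1 x s2 : unmark F (size s1).+1 (s1 ++ x :: s2) = F s1 x s2.
Proof.
rewrite /unmark size_cat /= addnS ltnS leq_addr take_size_cat //.
by rewrite nth_cat ltnn subnn -cat_rcons drop_size_cat // size_rcons.
Qed.

Lemma unmark_multilinear n F : marked_multilinear n F -> multilinear n (unmark F).
Proof.
move=> [lm ll lr] r s1 s2 k x y e.
have [/andP[]|r_out] := boolP (0 < r <= n)%N; last first.
  by rewrite /unmark !size_cat /= e (negbTE r_out) scaler0 addr0.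
(* The varied entry sits at position [size s1]: it lies to the right of the mark [p], to its left,
   or on it. *)
case: r => // p _ pn; have [ps|ps|->] := ltngtP p (size s1).
- have [u [w [v [es sz]]]] := seq_split_at ps; rewrite es -sz -!catA !cat_cons !unmarkE.
  by apply: lr; rewrite -e es !size_cat /=; lia.
- have [|u [w [v [es sz]]]] := @seq_split_at _ (p - (size s1).+1) s2; first by lia.
  have -> : p = size (s1 ++ x :: u) by rewrite size_cat /= sz; lia.
  have sE z : (size (s1 ++ x :: u) = size (s1 ++ z :: u))%N by rewrite !size_cat.
  have cE z : s1 ++ z :: s2 = (s1 ++ z :: u) ++ w :: v by rewrite es -catA.
  rewrite !cE {1}(sE (k *: x + y)) {2}(sE y) !unmarkE.
  by apply: ll; rewrite -e es !size_cat /=; lia.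
- by rewrite !unmarkE; apply: lm.
Qed.

(** The faces with index at most [size s1]: products inside [s1], then the last entry of [s1] acting
    on the mark by [dsc]. The remaining faces form [bdR]. *)
Definition bdL F s1 x s2 : W :=
  if s1 is a :: u then
    \sum_(0 <= j < size u) (-1) ^+ j *: F (star_at j s1) x s2
    + (-1) ^+ size u *: F (belast a u) (dsc (last a u) x) s2
  else 0.

Definition bdR F s1 x s2 : W :=
  (-1) ^+ size s1 *: (if s2 is b :: v then
    F s1 (dpr x b) v - \sum_(0 <= j < size v) (-1) ^+ j *: F s1 x (star_at j s2)
  else 0).

Definition cobd phi (r : nat) (xs : seq E) : W :=
  \sum_(j <- iota 1 (size xs).-1)
    (-1) ^+ j.+1 *: phi (face_idx j r) (face_tensor j r xs).

Lemma bdL_rcons F u a x s2 : bdL F (rcons u a) x s2 =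
  \sum_(0 <= j < size u) (-1) ^+ j *: F (star_at j (rcons u a)) x s2
  + (-1) ^+ size u *: F u (dsc a x) s2.
Proof.
case: u => [|b u]; first by [].
by rewrite rcons_cons /bdL size_rcons belast_rcons last_rcons.
Qed.

Lemma face_tensor_left j s1 x s2 : (j.+1 < size s1)%N ->
  face_tensor j.+1 (size s1).+1 (s1 ++ x :: s2) = star_at j s1 ++ x :: s2.
Proof.
move=> js; rewrite /face_tensor /face_op ltnS js /star_at -catA cat_cons.
rewrite !nth_cat take_cat drop_cat js (ltn_trans (ltnSn j) js).
case: ltnP => // sj; rewrite (drop_oversize sj).
by rewrite (_ : (j.+2 - size s1)%N = 0%N) ?drop0 //; lia.
Qed.

Lemma face_tensor_dsc u a x s2 :
  face_tensor (size u).+1 (size u).+2 (rcons u a ++ x :: s2) = u ++ dsc a x :: s2.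
Proof.
rewrite /face_tensor /face_op ltnn eqxx -cats1 -catA /=.
by have [-> -> -> ->] := split_pair 0 u a x s2.
Qed.

Lemma face_tensor_dpr s1 x b v :
  face_tensor (size s1).+1 (size s1).+1 (s1 ++ x :: b :: v) = s1 ++ dpr x b :: v.
Proof.
rewrite /face_tensor /face_op ltnNge leqnSn gtn_eqF // eqxx /=.
by have [-> -> -> ->] := split_pair 0 s1 x b v.
Qed.

Lemma face_tensor_right j s1 x s2 :
  face_tensor ((size s1).+2 + j) (size s1).+1 (s1 ++ x :: s2)
    = s1 ++ x :: star_at j s2.
Proof.
rewrite /face_tensor /face_op /star_at.
rewrite (_ : _ < _ = false)%N; last by lia.
rewrite (_ : _ == _ = false)%N; last by lia.
rewrite (_ : _ == _ = false)%N; last by lia.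
have sz := size_rcons s1 x.
rewrite -(cat_rcons x s1 s2) (_ : (_ + j).-1 = size (rcons s1 x) + j)%N; last by lia.
rewrite (_ : (_.+2 + j).+1 = size (rcons s1 x) + j.+2)%N; last by lia.
rewrite (_ : (_.+2 + j) = size (rcons s1 x) + j.+1)%N; last by lia.
rewrite take_cat drop_cat !nth_cat !ltnNge !leq_addr /= !addKn.
by rewrite -catA cat_rcons.
Qed.

(** The range of face indices is cut at [size s1]. *)
Lemma cobd_mark phi s1 x s2 :
  cobd phi (size s1).+1 (s1 ++ x :: s2) =
  bdL (mark phi) s1 x s2 + bdR (mark phi) s1 x s2.
Proof.
rewrite /cobd size_cat /= addnS /= iotaD big_cat; congr (_ + _).
- case/lastP: s1 => [|u a]; first by rewrite big_nil.
  rewrite bdL_rcons size_rcons.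
  (* The last face of the left half is the one that touches the mark. *)
  rewrite [iota 1 _](_ : _ = iota 1 (size u) ++ [:: (size u).+1]); last first.
    by rewrite -[(size u).+1]addn1 iotaD addnC.
  rewrite big_cat big_seq1 /=; congr (_ + _).
    rewrite (iotaDl 1 0) big_map /index_iota subn0 big_seq [RHS]big_seq.
    apply: eq_bigr => j; rewrite mem_iota add0n /= => ju.
    have jr : (j.+1 < size (rcons u a))%N by rewrite size_rcons.
    rewrite add1n exprS exprS mulrA mulrNN !mul1r; congr (_ *: _).
    rewrite -[X in face_tensor _ X](congr1 succn (size_rcons u a)) face_tensor_left //.
    by rewrite /mark size_star_at // size_rcons /face_idx ltnS ltnW.
  rewrite face_tensor_dsc exprS exprS mulrA mulrNN !mul1r /face_idx ltnSn.
  by [].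
- rewrite /bdR add1n; case: s2 => [|b v] /=; first by rewrite big_nil scaler0.
  rewrite big_cons face_tensor_dpr /face_idx ltnn scalerDr.
  rewrite exprS exprS mulrA mulrNN !mul1r; congr (_ + _).
  rewrite -[(size s1).+2]addn0 iotaDl big_map /index_iota subn0 scalerN scaler_sumr.
  rewrite -sumrN; apply: eq_bigr => j _.
  rewrite face_tensor_right scalerA -exprD -scaleNr ltnNge /=.
  rewrite (_ : _ <= _)%N; last by lia.
  by rewrite -[LHS]/(_ *: mark _ _ _ _) !addSn !exprS !mulN1r !opprK.
Qed.

(** * The homotopy and its commutation with the faces *)

Variables (decl decr : E -> seq (E * E)).
Hypotheses (declP : left_contraction decl) (decrP : right_contraction decr).
Local Notation res := (residue decl).

Lemma bilinear_dsc : bilinear_map (@dsc K E).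
Proof. by split; [exact: dsc_linl | exact: dsc_linr]. Qed.


Lemma residue_klinear : klinear res.
Proof.
have [lin _ _] := declP bilinear_dsc.
by move=> a x y; rewrite /residue lin scalerBr opprD addrACA.
Qed.

Lemma residue_dpr x y : res (dpr x y) = dpr (res x) y.
Proof.
rewrite /residue; have [_ -> _] := declP bilinear_dsc.
rewrite (klinearD (dpr_linl _)) (klinearN (dpr_linl _)).
rewrite [in RHS](klinear_sum (dpr_linl _)).
by congr (_ - _); apply: eq_bigr => t _; rewrite -dend_ax2.
Qed.

(** Contracting [dsc x y] with [dsc] gives [dsc x] of the residue of [y] plus [dsc x] of the
    contraction of [y], which is [dsc x y] again. *)
Lemma residue_dsc x y : res (dsc x y) = 0.
Proof.
have [_ _ e] := declP bilinear_dsc.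
rewrite {1}/residue e (_ : contr _ _ y = dsc x (contr decl (@dsc K E) y)); last first.
  by rewrite [RHS](klinear_sum (dsc_linr _)); apply: eq_bigr => t _; rewrite dsc_dsc.
by rewrite -(klinearD (dsc_linr _)) subrK subrr.
Qed.

(** Transpose of replacing the marked [x] by its left contraction [l (x) y], with [l] joining the
    left part and [y] marked. *)
Definition hL F s1 x s2 : W :=
  (-1) ^+ size s1 *: contr decl (fun l y => F (rcons s1 l) y s2) x.

(** Repairs the defect [F [::] (res x) s2] that [hL] leaves when the left part is empty, by
    contracting that residue on the right. *)
Definition hR F s1 x s2 : W :=
  if s1 is [::] then contr decr (fun y t => F [::] y (t :: s2)) (res x) else 0.

Section Identities.
Variables (n : nat) (F : seq E -> E -> seq E -> W).
Hypothesis linF : marked_multilinear n F.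

Lemma bilinear_left s1 s2 : (size s1 + (size s2).+2)%N = n ->
  bilinear_map (fun l y => F (rcons s1 l) y s2).
Proof.
case: linF => lm ll _ e; split=> [y|l] a z w.
  by rewrite -!cats1 ll // -e !addnS addn0.
by rewrite lm // size_rcons -e !addnS.
Qed.

Lemma bilinear_right s2 : (size s2).+2 = n ->
  bilinear_map (fun y t => F [::] y (t :: s2)).
Proof.
case: linF => lm _ lr e; split=> [t|y] a z w; first by rewrite lm.
by rewrite (lr [::] y [::] s2).
Qed.

(** Merging [l] back into [y] gives the contraction of [x] by [dsc]. For nonempty [s1] the [dsc]
    clause of the left contraction supplies the missing residue, and its other term cancels the face
    merging the last entry of [s1] with [l]. For empty [s1] nothing supplies the residue. *)
Lemma bdL_hL s1 x s2 : (size s1 + (size s2).+1)%N = n ->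
  bdL (hL F) s1 x s2 + hL (bdL F) s1 x s2 =
  F s1 x s2 - (if s1 is [::] then F [::] (res x) s2 else 0).
Proof.
case: (linF) => lm _ _; case/lastP: s1 => [|u a] e.
  rewrite add0r /hL expr0 scale1r /=.
  have lF : klinear (fun y => F [::] y s2) by exact: lm.
  rewrite -(klinearN lF) -(klinearD lF) subKr [RHS](klinear_sum lF).
  by apply: eq_bigr => t _; rewrite big_nil add0r scale1r.
have e' : (size u + (size s2).+2)%N = n by rewrite -e size_rcons addSnnS.
have [_ _ eq_sc] := declP (bilinear_left e').
rewrite (_ : (if _ is [::] then _ else 0) = 0); last by case: (u).
rewrite subr0 bdL_rcons [hL (bdL F) _ _ _]/hL size_rcons.
(* Three kinds of faces: inside [s1], the last entry [a] with the new [l], and [l] with the mark. *)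
rewrite (_ : contr decl _ x =
  \sum_(0 <= j < size u) (-1) ^+ j *:
      contr decl (fun l y => F (rcons (star_at j (rcons u a)) l) y s2) x
  + (-1) ^+ size u *: contr decl (fun l y => F (rcons u (dstar a l)) y s2) x
  + (-1) ^+ (size u).+1 *: contr decl (fun l y => F (rcons u a) (dsc l y) s2) x);
  last first.
  rewrite -!contrZ -(eq_bigr _ (fun j _ => contrZ _ _ _ _)) -contr_sum -!contrD.
  apply: eq_bigr => t _; rewrite bdL_rcons size_rcons big_nat_recr //=.
  rewrite star_at_last; congr (_ + _ + _).
  rewrite big_nat [RHS]big_nat; apply: eq_bigr => j /andP[_ ju].
  by rewrite star_at_rcons // size_rcons.
rewrite [hL F u _ _]/hL eq_sc.
have lF : klinear (fun y => F (rcons u a) y s2) by exact: lm.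
rewrite (_ : contr decl (fun l y => F (rcons u a) (dsc l y) s2) x =
  F (rcons u a) (contr decl (@dsc K E) x) s2); last first.
  by rewrite [RHS](klinear_sum lF).
set e1 := (-1) ^+ size u; have e11 : e1 * e1 = 1 by rewrite -expr2 sqrr_sign.
set S := \sum_(0 <= j < _) _ *: contr _ _ _.
rewrite (_ : \sum_(0 <= j < _) _ *: hL _ _ _ _ = e1 *: S); last first.
  rewrite scaler_sumr big_nat [RHS]big_nat; apply: eq_bigr => j /andP[_ ju].
  by rewrite /hL size_star_at size_rcons ?ltnS // !scalerA mulrC.
rewrite exprS mulN1r !scaleNr -/e1 !scalerDr !scalerN !scalerA e11 !scale1r.
rewrite (klinearD lF) (klinearN lF) -/(residue decl x).
set t := contr _ _ _; set c := contr _ _ _.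
by rewrite -[X in _ + X - _]addrA [- _ + c]addrC addrCA -[X in _ - X]addrA addrK.
Qed.

(** The left contraction commutes with right multiplication, and inserting [l] shifts every right
    face by one place, hence the opposite sign. *)
Lemma bdR_hL s1 x s2 : (size s1 + (size s2).+1)%N = n ->
  bdR (hL F) s1 x s2 + hL (bdR F) s1 x s2 = 0.
Proof.
case: s2 => [|b v] e.
  rewrite /bdR /hL scaler0 add0r [contr _ _ _]big1 ?scaler0 // => t _.
  by rewrite scaler0.
have e' : (size s1 + (size v).+2)%N = n by rewrite -e.
have [_ eq_pr _] := declP (bilinear_left e').
rewrite /bdR {1}/hL eq_pr [hL _ _ _ _]/hL -scalerDr.
rewrite [X in _ + X](_ : _ = (-1) ^+ (size s1).+1 *:
  (contr decl (fun l y => F (rcons s1 l) (dpr y b) v) x -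
   \sum_(0 <= j < size v) (-1) ^+ j *:
     contr decl (fun l y => F (rcons s1 l) y (star_at j (b :: v))) x)); last first.
  rewrite -(eq_bigr _ (fun j _ => contrZ _ _ _ _)) -contr_sum.
  rewrite -[- contr _ _ _]scaleN1r -contrZ -contrD -contrZ.
  by apply: eq_bigr => t _; rewrite size_rcons scaleN1r.
rewrite exprS mulN1r scaleNr scalerBr scaler_sumr.
rewrite (eq_bigr (fun j => (-1) ^+ size s1 *: ((-1) ^+ j *:
     contr decl (fun l y => F (rcons s1 l) y (star_at j (b :: v))) x))); last first.
  by move=> j _; rewrite /hL !scalerA mulrC.
by rewrite -!scaler_sumr subrr scaler0.
Qed.

(** [hR] vanishes on a nonempty left part, and the only face that empties it produces a [dsc]
    product, whose residue is zero. *)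
Lemma bdL_hR s1 x s2 : (size s1 + (size s2).+1)%N = n ->
  bdL (hR F) s1 x s2 = 0.
Proof.
case/lastP: s1 => [|u a] e //; rewrite bdL_rcons big1 ?add0r => [|j _].
  case: u e => [|b u] e; last by rewrite scaler0.
  rewrite scale1r /hR residue_dsc.
  case: (decrP (bilinear_right (s2 := s2) _)) => [|lin _]; first by rewrite -e.
  exact: klinear0 lin.
by rewrite /hR; case: star_at (star_at_neq0 j (rcons u a)) => // *; rewrite scaler0.
Qed.

(** The mirror of the argument for [bdL_hL], applied to [res x]; it works because the residue
    commutes with [dpr]. *)
Lemma bdR_hR s1 x s2 : (size s1 + (size s2).+1)%N = n -> (1 < n)%N ->
  bdR (hR F) s1 x s2 + hR (bdL F) s1 x s2 + hR (bdR F) s1 x s2 =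
  if s1 is [::] then F [::] (res x) s2 else 0.
Proof.
case: s1 => [|a s1]; last first.
  move=> _ _; rewrite /hR /bdR !addr0; case: s2 => [|b v]; first by rewrite scaler0.
  by rewrite big1 ?subr0 ?scaler0 // => j _; rewrite scaler0.
(* With empty left part, [1 < n] forces an entry [b] to the right of the mark. This is where degree
   [1] is excluded. *)
case: s2 => [<- //|b v] e _.
have e' : (size v).+2 = n by rewrite -e.
have [_ eq_pr] := decrP (bilinear_right e').
rewrite (_ : hR (bdL F) [::] x (b :: v) = 0); last by rewrite /hR [LHS]big1.
rewrite addr0 (_ : bdR (hR F) _ _ _ = F [::] (res x - contr decr (@dpr K E) (res x)) (b :: v)
  + contr decr (fun y t => F [::] y (dstar t b :: v)) (res x)
  - \sum_(0 <= j < size v) (-1) ^+ j *: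
       contr decr (fun y t => F [::] y (t :: star_at j (b :: v))) (res x)); last first.
  by rewrite /bdR scale1r /hR residue_dpr eq_pr.
rewrite (_ : hR (bdR F) [::] x (b :: v) =
   F [::] (contr decr (@dpr K E) (res x)) (b :: v)
   - contr decr (fun y t => F [::] y (dstar t b :: v)) (res x)
   + \sum_(0 <= j < size v) (-1) ^+ j *:
       contr decr (fun y t => F [::] y (t :: star_at j (b :: v))) (res x)).
  have lF : klinear (fun y => F [::] y (b :: v)) by case: linF => lm _ _; exact: lm.
  rewrite (klinearB lF).
  set d := F _ (contr _ _ _) _; set c := contr _ _ _; set S := \sum_(_ <= _ < _) _.
  set f := F _ _ _.
  rewrite (_ : d - c + S = - (- d + (c - S))); last by rewrite !opprD !opprK addrA.
  by rewrite -(addrA (f - d)) -(addrA f) addrK.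
rewrite [X in X - _ + _](klinear_sum (f := fun y => F [::] y (b :: v))); last first.
  by case: linF => lm _ _; apply: lm.
rewrite -(eq_bigr _ (fun j _ => contrZ _ _ _ _)) -contr_sum.
rewrite -[- contr _ _ _]scaleN1r -contrZ /hR /contr -!big_split; apply: eq_bigr => t _ /=.
(* Among the products in [t :: b :: v], index [0] merges [t] with [b]; the others are those of
   [b :: v] shifted by one, which flips their sign. *)
rewrite /bdR scale1r scaleN1r /= big_nat_recl //= expr0 scale1r /star_at /= drop0.
rewrite opprD addrA -sumrN; congr (_ + _); apply: eq_bigr => j _.
by rewrite exprS mulN1r scaleNr opprK.
Qed.

End Identities.

Definition homotopy phi : nat -> seq E -> W :=
  unmark (fun s1 x s2 => hL (mark phi) s1 x s2 + hR (mark phi) s1 x s2).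

Lemma hL_multilinear n F : marked_multilinear n.+1 F -> marked_multilinear n (hL F).
Proof.
move=> linF; have [lm ll lr] := linF; split=> [s1 s2 e|u1 u2 x s2 e|s1 x u1 u2 e].
- apply: klinear_scale.
  by case: (declP (bilinear_left linF (s1 := s1) (s2 := s2) _)); rewrite // -e addnS.
- move=> k z w; rewrite /hL !size_cat /=; move: k z w.
  apply/klinear_scale/klinear_contr => l y k z w; rewrite !rcons_cat /= ll //.
  by rewrite size_rcons -e; lia.
- apply/klinear_scale/klinear_contr => l y; apply: lr.
  by rewrite size_rcons -e; lia.
Qed.

Lemma hR_multilinear n F : marked_multilinear n.+1 F -> marked_multilinear n (hR F).
Proof.
move=> linF; have [lm ll lr] := linF; split=> [s1 s2 e|u1 u2 x s2 e|s1 x u1 u2 e].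
- case: s1 e => [|a u] e; last exact: klinear_cst0.
  case: (decrP (bilinear_right linF (s2 := s2) _)) => [|lin _]; first by rewrite -e.
  exact: klinear_comp lin residue_klinear.
- by move=> k z w; rewrite /hR; case: u1 {e} => [|a u1] /=; rewrite scaler0 addr0.
- case: s1 e => [|a u] e; last exact: klinear_cst0.
  apply: klinear_contr => y t; apply: (lr [::] y (t :: u1)).
  by move: e => /=; lia.
Qed.

Lemma homotopy_multilinear n phi :
  multilinear n.+1 phi -> multilinear n (homotopy phi).
Proof.
move=> /mark_multilinear linphi; apply: unmark_multilinear.
have [lm ll lr] := hL_multilinear linphi; have [rm rl rr] := hR_multilinear linphi.
split=> *; apply: klinear_add; auto.
Qed.

(** Of the eight composites, the four with [hL] sum to [phi] minus the residue term, and the four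
    with [hR] restore that term. *)
Lemma cobd_homotopy n phi r xs : multilinear n phi -> (1 < n)%N ->
  (0 < r <= n)%N -> size xs = n ->
  cobd (homotopy phi) r xs + homotopy (cobd phi) r xs = phi r xs.
Proof.
move=> /mark_multilinear linF n1 /andP[r0 rn] sz.
case: r r0 rn => // p _ pn; rewrite -sz in pn.
have [s1 [x [s2 [exs <-]]]] := seq_split_at pn; subst xs.
have e : (size s1 + (size s2).+1)%N = n by rewrite -sz size_cat.
rewrite cobd_mark [homotopy (cobd phi) _ _]unmarkE.
have -> : mark (homotopy phi) = fun s1 x s2 => hL (mark phi) s1 x s2 + hR (mark phi) s1 x s2.
  by apply/funext => u; apply/funext => y; apply/funext => v; rewrite /mark /homotopy unmarkE.
have -> : mark (cobd phi) = fun s1 x s2 => bdL (mark phi) s1 x s2 + bdR (mark phi) s1 x s2.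
  by apply/funext => u; apply/funext => y; apply/funext => v; rewrite /mark cobd_mark.
have bdLD F G : bdL (fun u y v => F u y v + G u y v) s1 x s2 = bdL F s1 x s2 + bdL G s1 x s2.
  rewrite /bdL; case: (s1) => [|a u]; first by rewrite addr0.
  rewrite addrACA -scalerDr -big_split; congr (_ + _).
  by apply: eq_bigr => j _; rewrite scalerDr.
have bdRD F G : bdR (fun u y v => F u y v + G u y v) s1 x s2 = bdR F s1 x s2 + bdR G s1 x s2.
  rewrite /bdR -scalerDr; congr (_ *: _); case: (s2) => [|b v]; first by rewrite addr0.
  rewrite addrACA -opprD -big_split; congr (_ - _).
  by apply: eq_bigr => j _; rewrite scalerDr.
have hLD F G : hL (fun u y v => F u y v + G u y v) s1 x s2 = hL F s1 x s2 + hL G s1 x s2.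
  by rewrite /hL contrD scalerDr.
have hRD F G : hR (fun u y v => F u y v + G u y v) s1 x s2 = hR F s1 x s2 + hR G s1 x s2.
  by rewrite /hR; case: (s1) => [|a u]; rewrite ?addr0 // contrD.
rewrite bdLD bdRD hLD hRD (bdL_hR linF x e) addr0 [X in X + _ = _]addrA addrACA.
rewrite [X in X + _]addrACA (bdL_hL linF x e) (bdR_hL linF x e) addr0.
by rewrite [X in _ + X]addrA (bdR_hR linF x e n1) subrK.
Qed.

End MarkedComplex.

(** * From functionals back to formal sums; vanishing in degrees above one *)

Section ChainLevel.
Variables (K : fieldType) (E : dendAlg K).
Implicit Types (c : seq (term E)) (t : term E).

Lemma eval_chain_cat (W : lmodType K) (phi : nat -> seq E -> W) c1 c2 :
  eval_chain phi (c1 ++ c2) = eval_chain phi c1 + eval_chain phi c2.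
Proof. exact: big_cat. Qed.

Lemma eval_chain_opp (W : lmodType K) (phi : nat -> seq E -> W) c :
  eval_chain phi (chain_opp c) = - eval_chain phi c.
Proof. by rewrite /eval_chain big_map -sumrN; apply: eq_bigr => t _; rewrite scaleNr. Qed.

Lemma eval_chain_flatten (W : lmodType K) (phi : nat -> seq E -> W)
    (T : term E -> seq (term E)) c :
  eval_chain phi (flatten (map T c)) = \sum_(t <- c) eval_chain phi (T t).
Proof. by rewrite /eval_chain big_flatten big_map. Qed.

Lemma eval_boundary (W : lmodType K) (phi : nat -> seq E -> W) n c :
  wf_chain n c -> eval_chain phi (boundary n c) = eval_chain (cobd phi) c.
Proof.
move=> /allP wf; rewrite eval_chain_flatten /eval_chain !big_seq.
apply: eq_bigr => t /wf /andP[_ /eqP sz]; rewrite big_map scaler_sumr sz.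
by apply: eq_bigr => j _; rewrite scalerA mulrC.
Qed.

Lemma chain_zero_sub n c b : wf_chain n.+1 b ->
  (forall (W : lmodType K) (phi : nat -> seq E -> W), multilinear n phi ->
     eval_chain phi c = eval_chain (cobd phi) b) ->
  is_boundary n c.
Proof.
move=> wfb e; exists b; split=> // W phi lin.
by rewrite eval_chain_cat eval_chain_opp eval_boundary // e // subrr.
Qed.

Variables (decl decr : E -> seq (E * E)).
Hypotheses (declP : left_contraction decl) (decrP : right_contraction decr).

(** The homotopy on chains, whose transpose is [homotopy]; it supplies the explicit bounding chain.
    The first list moves the mark to [r.+1], the second keeps it at [1]. *)
Definition homotopy_term t : seq (term E) :=
  let s1 := take t.1.2.-1 t.2 in let x := nth 0 t.2 t.1.2.-1 in
  let s2 := drop t.1.2 t.2 in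
  [seq ((-1) ^+ size s1 * t.1.1, t.1.2.+1, rcons s1 d.1 ++ d.2 :: s2) | d <- decl x]
  ++ (if s1 is [::] then
        [seq (t.1.1, 1, d.1 :: d.2 :: s2) | d <- decr (residue decl x)] else [::]).

Definition homotopy_chain c := flatten (map homotopy_term c).

Lemma term_split n t : (0 < t.1.2 <= n)%N && (size t.2 == n) ->
  exists s1 x s2, t = (t.1.1, (size s1).+1, s1 ++ x :: s2) /\ (size s1 + (size s2).+1)%N = n.
Proof.
case: t => [[k r] xs] /= /andP[/andP[r0 rn] /eqP sz].
case: r r0 rn => // p _; rewrite -sz => /seq_split_at[s1 [x [s2 [-> <-]]]].
by exists s1, x, s2; rewrite size_cat.
Qed.

Lemma homotopy_termE k s1 x s2 :
  homotopy_term (k, (size s1).+1, s1 ++ x :: s2) =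
  [seq ((-1) ^+ size s1 * k, (size s1).+2, rcons s1 d.1 ++ d.2 :: s2) | d <- decl x]
  ++ (if s1 is [::] then
        [seq (k, 1, d.1 :: d.2 :: s2) | d <- decr (residue decl x)] else [::]).
Proof.
rewrite /homotopy_term /= take_size_cat // nth_cat ltnn subnn /= -cat_rcons.
by rewrite drop_size_cat // size_rcons.
Qed.

Lemma wf_homotopy_chain n c : wf_chain n c -> wf_chain n.+1 (homotopy_chain c).
Proof.
move=> /allP wf; apply/allP => t' /flattenP[_ /mapP[t /wf /term_split ht ->]].
have [s1 [x [s2 [-> e]]]] := ht; rewrite homotopy_termE mem_cat => /orP[/mapP[d _ ->]|] /=.
  by rewrite size_cat size_rcons /=; lia.
by case: s1 e => // e /mapP[d _ ->] /=; move: e => /=; lia.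
Qed.

Lemma eval_homotopy_chain (W : lmodType K) (phi : nat -> seq E -> W) n c :
  wf_chain n c -> eval_chain phi (homotopy_chain c) = eval_chain (homotopy decl decr phi) c.
Proof.
move=> /allP wf; rewrite eval_chain_flatten /eval_chain !big_seq.
apply: eq_bigr => t /wf /term_split[s1 [x [s2 [-> e]]]].
rewrite homotopy_termE /homotopy unmarkE /= big_cat scalerDr; congr (_ + _).
  rewrite /hL /contr !scaler_sumr big_map; apply: eq_bigr => d _ /=.
  by rewrite /mark size_rcons mulrC scalerA.
rewrite /hR; case: (s1) => [|a u]; last by rewrite big_nil scaler0.
by rewrite big_map /contr scaler_sumr; apply: eq_bigr.
Qed.

Lemma homology_vanishes_gt1 n : (1 < n)%N -> homology_vanishes E n.
Proof.
case: n => // n n1 c wfc cyc; apply: (chain_zero_sub (wf_homotopy_chain wfc)) => W phi lin.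
rewrite (eval_homotopy_chain _ wfc).
(* Testing the cycle condition on [homotopy phi] kills one of the two terms of the homotopy formula;
   the other is [cobd phi] on the homotopy chain. *)
have := cyc _ _ (homotopy_multilinear declP decrP lin).
rewrite (eval_boundary _ wfc) => e0; rewrite -[RHS]add0r -[X in X + _]e0.
rewrite /eval_chain -big_split /= big_seq [RHS]big_seq; apply: eq_bigr => t /(allP wfc).
move=> /andP[r_n /eqP sz]; rewrite -scalerDr.
by rewrite (cobd_homotopy declP decrP lin n1 r_n sz).
Qed.

End ChainLevel.

(** * The first homology *)

Section FirstHomology.
Variables (K : fieldType) (V : lmodType K) (E : dendAlg K) (i : V -> E).
Hypothesis freeE : free_dend_on i.

(** [V] with zero products: extending the identity of [V] to it gives a projection of [E] that kills
    all products. *)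
Definition trivial_dend : dendAlg K.
Proof.
by apply: (@DendAlg K V (fun _ _ => 0) (fun _ _ => 0)) => *; rewrite ?addr0 //;
  exact: klinear_cst0.
Defined.

(** Boundaries of degree-[2] chains are sums of products, and every [x] is [i (g x)] plus such a
    sum. As [g] kills products, it induces the isomorphism. *)
Lemma homology1 : homology_iso E 1 V.
Proof.
case: (freeE) => li /(_ trivial_dend id (@klinear_id _ _)) [g [[lg [gpr gsc]] gi _]].
(* On two entries the single face is [dpr] for [r = 1] and [dsc] for [r = 2], so [b] encodes a sum
   of products. *)
have decomp x : exists2 b, wf_chain 2 b &
    x = i (g x) + eval_chain (fun r s => nth 0 (face_tensor 1 r s) 0) b.
  elim/(free_ind freeE): x => [v|k x y [b wfb ex] [b' wfb' ey]|x y _ _|x y _ _].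
  - by exists [::]; rewrite // gi /eval_chain big_nil addr0.
  - exists ([seq (k * t.1.1, t.1.2, t.2) | t <- b] ++ b').
      by rewrite /wf_chain all_cat all_map; apply/andP.
    rewrite {1}ex {1}ey lg li eval_chain_cat scalerDr addrACA /eval_chain big_map.
    by rewrite scaler_sumr; congr (_ + (_ + _)); apply: eq_bigr => t _; rewrite scalerA.
  - exists [:: (1, 1%N, [:: x; y])] => //.
    by rewrite /eval_chain big_seq1 scale1r gpr (klinear0 li) add0r.
  - exists [:: (1, 2%N, [:: x; y])] => //.
    by rewrite /eval_chain big_seq1 scale1r gsc (klinear0 li) add0r.
pose psi (r : nat) (s : seq E) : V := g (head 0 s).
have psi_lin : multilinear 1 psi.
  move=> r [|? ?] [|? ?] a x y; rewrite ?(addnS, addSn) // => _.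
  exact: (lg a x y).
have cobd1 (W : lmodType K) (f : E -> W) : klinear f -> forall b, wf_chain 2 b ->
    eval_chain (cobd (fun _ s => f (head 0 s))) b =
    f (eval_chain (fun r s => nth 0 (face_tensor 1 r s) 0) b).
  move=> lf b /allP wf; rewrite [RHS](klinear_sum lf) /eval_chain !big_seq.
  apply: eq_bigr => t /wf /andP[_ /eqP sz]; rewrite /cobd sz big_seq1 expr2 mulrNN.
  by rewrite mulr1 scale1r (klinearZ lf); case: (face_tensor _ _ _).
(* A degree-[1] chain amounts to one element of [E]. *)
have wf1 c : wf_chain 1 c -> forall (W : lmodType K) (phi : nat -> seq E -> W),
    multilinear 1 phi ->
    eval_chain phi c = phi 1%N [:: \sum_(t <- c) t.1.1 *: head 0 t.2].
  move=> /allP wf W phi lin.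
  have lphi : klinear (fun x => phi 1%N [:: x]) by move=> a x y; apply: (lin 1%N [::] [::]).
  rewrite [RHS](klinear_sum lphi) /eval_chain !big_seq; apply: eq_bigr => -[[k r] s] /wf /=.
  move=> /andP[r1 /eqP sz]; have -> : r = 1%N by lia.
  case: s sz => [|x [|y s]] // _.
  exact: esym (klinearZ lphi k x).
exists psi; split=> // [v|c wfc _].
  exists [:: (1, 1%N, [:: i v])]; split=> //.
    (* There are no faces in degree [1], so every chain is a cycle. *)
    by move=> W phi _; rewrite /eval_chain big_nil.
  by rewrite /eval_chain big_seq1 scale1r; exact: gi.
split=> [psi0|[b [wfb zb]]].
  have [b wfb eb] := decomp (\sum_(t <- c) t.1.1 *: head 0 t.2).
  apply: (chain_zero_sub wfb) => W phi lin; rewrite (wf1 _ wfc) //.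
  have lphi : klinear (fun x => phi 1%N [:: x]) by move=> a x y; apply: (lin 1%N [::] [::]).
  move: psi0; rewrite (wf1 _ wfc) // /psi /= => g0.
  rewrite {1}eb g0 (klinear0 li) add0r -(cobd1 _ _ lphi) //.
  rewrite /eval_chain !big_seq; apply: eq_bigr => t /(allP wfb) /andP[/andP[r0 r2] /eqP sz].
  rewrite /cobd sz !big_seq1; congr (_ *: (_ *: _)).
  move: t.1.2 r0 r2 => r r0 r2; move: sz; case: t.2 => [|x [|y []]] // _.
  by case: r r0 r2 => [|[|[]]].
(* Conversely, [psi] vanishes on boundaries because [g] sends products to [0]. *)
have := zb _ _ psi_lin; rewrite eval_chain_cat eval_chain_opp eval_boundary //.
move/subr0_eq ->; rewrite (cobd1 _ _ lg) // (klinear_sum lg) big_seq big1 // => t.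
move/(allP wfb) => /andP[/andP[r0 r2] /eqP sz]; rewrite (klinearZ lg).
move: t.1.2 r0 r2 => r r0 r2; move: sz; case: t.2 => [|x [|y []]] // _.
by case: r r0 r2 => [|[|[]]] //= _ _; rewrite /face_tensor /face_op /= ?gpr ?gsc scaler0.
Qed.

End FirstHomology.

Theorem theorem6p5 (K : fieldType) (hK : [pchar K] =i pred0)
  (V : lmodType K) (E : dendAlg K) (i : V -> E) :
  free_dend_on i ->
  homology_iso E 1 V /\ (forall n : nat, (1 < n)%N -> homology_vanishes E n).
Proof.
move=> freeE; split=> [|n n1]; first exact: homology1 freeE.
have [decl declP] := left_contraction_exists freeE.
have [decr decrP] := right_contraction_exists freeE.
exact: (homology_vanishes_gt1 declP decrP).
Qed.
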